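(* Let $h \ge p \ge 1$ be integers. Let $T$ be a finite tree with diameter at least $3$ or an infinite tree with finite maximum degree. Let $\Delta$ be the maximum degree of $T$ and $\Delta_2 = \max_{uv \in E(T)}(d(u)+d(v))$. Then $$\max\{(\Delta_2 - 1)p,\ h+(\Delta-1)p\} \le \lambda_{h,p,p}(T) \le \lambda^*_{h,p,p}(T) \le h + 2(\Delta - 1)p,$$ and both bounds are attainable (that is, there are integers $h \ge p \ge 1$ and a tree $T$ that is either finite with diameter at least $3$ or infinite with finite maximum degree, with $\lambda_{h,p,p}(T)$ equal to the lower bound, and there are integers $h \ge p \ge 1$ and a tree $T$ that is either finite with diameter at least $3$ or infinite with finite maximum degree, with $\lambda_{h,p,p}(T)$ equal to the upper bound). Moreover, there exists a linear time $(1+\varepsilon)$-factor approximation algorithm for the $L(h,p,p)$-labelling problem for the class of finite trees, where $\varepsilon = (\Delta - 1)/(\Delta_2 - 1) < 1$ (with $\Delta,\Delta_2$ those of the input tree).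
   Context: Graphs are undirected; an infinite graph means one with countably infinitely many vertices. $d(u)$ is the degree of a vertex $u$, $N(u)$ its neighbourhood, and $d(u,v)$ the distance between $u$ and $v$. For a graph $G$ and integers $h_1,h_2,h_3$, an $L(h_1,h_2,h_3)$-labelling of $G$ with span $\ell$ ($\ell$ a positive integer) is a mapping $f: V(G)\to\{0,1,\ldots,\ell\}$ such that for $i=1,2,3$ and any $u,v\in V(G)$ with $d(u,v)=i$ we have $|f(u)-f(v)|\ge h_i$. $\lambda_{h_1,h_2,h_3}(G)$ is the minimum span of an $L(h_1,h_2,h_3)$-labelling of $G$. An interval modulo $n$ is a set of the form $\{a \bmod n, (a+1) \bmod n, \ldots, b \bmod n\}$ (going cyclically from $a$ to $b$). An $L(h_1,h_2,h_3)$-labelling $f$ with span $\ell$ is elegant if for every vertex $u$ there is an interval $I_u$ modulo $\ell+1$ such that $f(N(u))\subseteq I_u$, and for every edge $uv$ of $G$, $I_u\cap I_v=\emptyset$. $\lambda^*_{h_1,h_2,h_3}(G)$ is the minimum $\ell$ such that $G$ admits an elegant $L(h_1,h_2,h_3)$-labelling with span $\ell$ ($\infty$ if none exists). The $L(h,p,p)$-labelling problem: given a finite tree $T$ (with at least one edge, so that $\Delta_2$ is defined), find an $L(h,p,p)$-labelling of minimum span. A linear time $\rho$-factor approximation algorithm is one running in time linear in $|V(T)|$ that outputs an $L(h,p,p)$-labelling of $T$ with span at most $\rho\,\lambda_{h,p,p}(T)$. *)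

(* Defs.v *)
From mathcomp Require Export all_boot all_order all_algebra.
From mathcomp Require Export finmap.
From mathcomp Require Export boolp classical_sets functions cardinality.

Set Implicit Arguments.
Unset Strict Implicit.
Unset Printing Implicit Defensive.

Local Open Scope classical_set_scope.

Definition is_minimum (P : set nat) (m : nat) : Prop :=
  P m /\ forall k, P k -> m <= k.

Definition is_maximum (P : set nat) (m : nat) : Prop :=
  P m /\ forall k, P k -> k <= m.

(** * Graphs, finite or countably infinite *)

Record graph (V : countType) := Graph {
  adj :> rel V;
  adj_sym : symmetric adj;
  adj_irr : irreflexive adj
}.

Section Graphs.
Variables (V : countType) (G : graph V).

Definition neighbourhood (u : V) : set V := [set v | G u v].

(* [fset_set] sends infinite sets to the empty one, so [deg] is meaningful
   only for vertices with a finite neighbourhood. *)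
Definition deg (u : V) : nat := #|` fset_set (neighbourhood u)|%fset.

Definition is_max_degree (D : nat) : Prop :=
  (forall u, finite_set (neighbourhood u)) /\
  is_maximum [set deg u | u in [set: V]] D.

Definition is_max_edge_degree (D2 : nat) : Prop :=
  is_maximum [set d | exists u v, G u v /\ d = deg u + deg v] D2.

Definition is_walk (u v : V) (k : nat) : Prop :=
  exists s : seq V, [/\ path G u s, last u s = v & size s = k].

Definition is_dist (u v : V) : nat -> Prop := is_minimum (is_walk u v).

Definition is_diameter : nat -> Prop :=
  is_maximum [set k | exists u v, is_dist u v k].

(* A closed walk u - v - u is a [ucycle] of size 2, hence the bound. *)
Definition is_tree : Prop :=
  (forall u v, exists k, is_walk u v k) /\
  (forall c : seq V, ucycle G c -> size c <= 2).

Definition admissible_tree : Prop :=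
  is_tree /\
  ((finite_set [set: V] /\ exists2 d, is_diameter d & 3 <= d) \/
   (infinite_set [set: V] /\ exists D, is_max_degree D)).

(** * Labellings *)

Definition is_labelling (h1 h2 h3 l : nat) (f : V -> nat) : Prop :=
  [/\ 0 < l,
      forall u, f u <= l &
      forall u v, [/\ is_dist u v 1 -> h1 <= `|f u - f v|%N,
                      is_dist u v 2 -> h2 <= `|f u - f v|%N &
                      is_dist u v 3 -> h3 <= `|f u - f v|%N]].

(* a > b in the cyclic sense is covered by taking b + n instead of b. *)
Definition is_interval_mod (n : nat) (I : set nat) : Prop :=
  exists a b, a <= b /\ I = [set k %% n | k in [set k | a <= k <= b]].

Definition is_elegant_labelling (h1 h2 h3 l : nat) (f : V -> nat) : Prop :=
  is_labelling h1 h2 h3 l f /\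
  exists I : V -> set nat,
    [/\ forall u, is_interval_mod l.+1 (I u),
        forall u, f @` neighbourhood u `<=` I u &
        forall u v, G u v -> I u `&` I v = set0].

Definition is_lambda (h1 h2 h3 : nat) : nat -> Prop :=
  is_minimum [set l | exists f, is_labelling h1 h2 h3 l f].

Definition is_lambda_star (h1 h2 h3 : nat) : nat -> Prop :=
  is_minimum [set l | exists f, is_elegant_labelling h1 h2 h3 l f].

End Graphs.

(** * Model of computation

   Structured programs for a unit-cost word RAM.  A program uses finitely many
   arrays of natural numbers, [s a i] being entry [i] of array [a] (a scalar
   variable is entry 0 of an array).  The names of the arrays are literals of
   the program, whereas indices are computed.  The only arithmetic operations
   are addition and truncated subtraction.  A number exceeding the word bound
   [W] has no representation: evaluating to it is an error, and a program that
   does so has no execution. *)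

Definition store := nat -> nat -> nat.

Inductive expr : Type :=
| Const of nat
| Get of nat & expr
| Add of expr & expr
| Sub of expr & expr.

Inductive cmd : Type :=
| Skip
| Write of nat & expr & expr          (* array, index, value *)
| Seq of cmd & cmd
| If of expr & cmd & cmd             (* nonzero means true *)
| While of expr & cmd.

Definition word (W k : nat) : option nat := if k <= W then Some k else None.

Fixpoint eval (W : nat) (s : store) (e : expr) : option nat :=
  match e with
  | Const k => word W k
  | Get a e1 => obind (fun i => word W (s a i)) (eval W s e1)
  | Add e1 e2 =>
      obind (fun x => obind (fun y => word W (x + y)) (eval W s e2))
            (eval W s e1)
  | Sub e1 e2 =>
      obind (fun x => obind (fun y => word W (x - y)) (eval W s e2))
            (eval W s e1)
  end.

Fixpoint cost (e : expr) : nat :=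
  match e with
  | Const _ => 1
  | Get _ e1 => (cost e1).+1
  | Add e1 e2 | Sub e1 e2 => (cost e1 + cost e2).+1
  end.

Definition update (s : store) (a i v : nat) : store :=
  fun b j => if (b == a) && (j == i) then v else s b j.

(* [exec W c s t s']: with word bound [W], the program [c] started in [s]
   halts in [s'] after [t] steps. *)
Inductive exec (W : nat) : cmd -> store -> nat -> store -> Prop :=
| ExecSkip s : exec W Skip s 1 s
| ExecSet a ei ev s i v :
    eval W s ei = Some i -> eval W s ev = Some v ->
    exec W (Write a ei ev) s (cost ei + cost ev).+1 (update s a i v)
| ExecSeq c1 c2 s1 s2 s3 t1 t2 :
    exec W c1 s1 t1 s2 -> exec W c2 s2 t2 s3 ->
    exec W (Seq c1 c2) s1 (t1 + t2) s3
| ExecIfTrue e c1 c2 s x t s' :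
    eval W s e = Some x.+1 -> exec W c1 s t s' ->
    exec W (If e c1 c2) s (cost e + t).+1 s'
| ExecIfFalse e c1 c2 s t s' :
    eval W s e = Some 0 -> exec W c2 s t s' ->
    exec W (If e c1 c2) s (cost e + t).+1 s'
| ExecWhileDone e c s :
    eval W s e = Some 0 -> exec W (While e c) s (cost e).+1 s
| ExecWhileStep e c s1 x t1 s2 t2 s3 :
    eval W s1 e = Some x.+1 -> exec W c s1 t1 s2 ->
    exec W (While e c) s2 t2 s3 ->
    exec W (While e c) s1 (cost e + t1 + t2).+1 s3.

(** * Algorithms on finite graphs *)

(* The lists of neighbours come in an arbitrary order. *)
Definition adjacency_lists n (G : graph 'I_n) (nb : 'I_n -> seq 'I_n) : Prop :=
  forall u, uniq (nb u) /\ forall v, (v \in nb u) = G u v.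

(* Initially array 0 holds n, array 2 the concatenation of the adjacency lists
   of vertices 0, ..., n - 1, and array 1 the n + 1 offsets delimiting these
   lists in array 2: the neighbours of u are the entries of array 2 from
   position [s 1 u] (included) to position [s 1 u.+1] (excluded).
   All other entries are 0. *)
Definition input n (nb : 'I_n -> seq 'I_n) : store :=
  let lists := [seq nb u | u <- enum 'I_n] in
  let offsets := mkseq (fun i => sumn (take i (shape lists))) n.+1 in
  let entries := [seq val v | v <- flatten lists] in
  fun a i => nth 0 (nth [::] [:: [:: n]; offsets; entries] a) i.

(* On termination, entry u of array 3 is the value computed for vertex u. *)
Definition output n (s : store) : 'I_n -> nat := fun u => s 3 u.

(* [A] computes, for every finite tree with at least one edge, a vertex map
   satisfying [Q], in a number of steps linear in the number n of vertices and
   using numbers at most linear in n, i.e. words of log n + O(1) bits. *)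
Definition solves_in_linear_time (A : cmd)
    (Q : forall n, graph 'I_n -> ('I_n -> nat) -> Prop) : Prop :=
  exists C : nat, forall n (T : graph 'I_n) (nb : 'I_n -> seq 'I_n),
    is_tree T -> (exists u v, T u v) -> adjacency_lists T nb ->
    exists t s, [/\ exec (C * n) A (input nb) t s, t <= C * n &
                    Q n T (output s)].

Definition approximates (h p : nat) (rho : rat) n (T : graph 'I_n)
    (f : 'I_n -> nat) : Prop :=
  exists l m, [/\ is_labelling T h p p l f, is_lambda T h p p m &
                  (l%:R <= rho * m%:R)%R].

Definition epsilon (D D2 : nat) : rat := ((D%:R - 1) / (D2%:R - 1))%R.

(* Main.v *)
Require Import Defs.
From mathcomp Require Import zify.

(** Lower bounds.  The neighbours of the two ends of an edge are pairwise at
    distance at most 3, so their labels are pairwise at least [p] apart, and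
    [k] such labels need a span of [(k - 1) * p] ([separated_span]).  Around a
    vertex [u] of maximum degree, the labels of the neighbours moreover avoid
    the open interval of radius [h] about the label of [u]; shifting those
    above it down by [h] keeps them separated and saves [h] ([star_span]).

    Upper bound.  Root the tree.  Give vertices of even depth labels among
    [0, p, ..., (D - 1) * p], and vertices of odd depth the same labels raised
    by [h + (D - 1) * p].  Vertices at odd distance are then at least [h]
    apart, and the two ranges of labels are disjoint intervals containing
    f(N(u)) and f(N(v)) for every edge [uv], so such a labelling is elegant as
    soon as any two neighbours of a vertex get different labels.  This is
    achieved from the root downwards: the children of [u] receive the
    successive labels of their range, passing over the label of the parent of
    [u]; there are at most [D] neighbours and [D] labels ([neighbour_slots],
    [label_elegant]).

    Sharpness.  On the one-way infinite path with [h = p = 1] both bounds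
    equal 3.

    Algorithm.  The downward construction runs in linear time.  Its span
    [h + 2 * (D - 1) * p] exceeds the lower bound [h + (D - 1) * p] by
    [(D - 1) * p], which is [epsilon D D2] times the lower bound
    [(D2 - 1) * p] ([span_ratio]).  The program is a breadth-first search with
    both its loops merged into one, so that every iteration takes a bounded
    time and either passes an entry of an adjacency list or leaves a vertex.
    Its correctness is the combination of three things: a rule for a loop with
    an invariant and a decreasing counter ([runs_while]), an invariant on
    queues that knows nothing about stores ([searching]), and the
    representation of such a queue, with the labels fixed beforehand by the
    mathematical definition [label], in a store ([represents]). *)

Set Implicit Arguments.
Unset Strict Implicit.
Unset Printing Implicit Defensive.

(** * Least and greatest natural numbers *)

Lemma ex_minimum (P : set nat) k : P k -> exists m, is_minimum P m.
Proof.
move=> Pk; have exP : exists k, `[< P k >] by exists k; apply/asboolP.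
case: (ex_minnP exP) => m /asboolP Pm min_m.
by exists m; split=> // j /asboolP /min_m.
Qed.

Lemma ex_maximum (P : set nat) k b :
  P k -> (forall j, P j -> j <= b) -> exists m, is_maximum P m.
Proof.
move=> Pk leb; have exP : exists k, `[< P k >] by exists k; apply/asboolP.
have ub j : `[< P j >] -> j <= b by move/asboolP/leb.
case: (ex_maxnP exP ub) => m /asboolP Pm max_m.
by exists m; split=> // j /asboolP /max_m.
Qed.

(** * Walks, distances and degrees *)

Section Walks.
Variables (V : countType) (G : graph V).

Lemma walk_adj u v : G u v -> is_walk G u v 1.
Proof. by move=> uv; exists [:: v]; rewrite /= uv. Qed.

Lemma walk_cat u v w k l :
  is_walk G u v k -> is_walk G v w l -> is_walk G u w (k + l).
Proof.
move=> [s [Gs us <-]] [t [Gt vt <-]]; exists (s ++ t).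
by rewrite cat_path last_cat size_cat Gs us Gt vt.
Qed.

Lemma walk_rev u v k : is_walk G u v k -> is_walk G v u k.
Proof.
move=> [s [Gs <- <-]]; exists (rev (belast u s)); split.
- rewrite rev_path; rewrite (eq_path (e' := G)) // => x y.
  exact: adj_sym.
- by case: s {Gs} => //= x s; rewrite rev_cons last_rcons.
- by rewrite size_rev size_belast.
Qed.

Lemma walk0 u v : is_walk G u v 0 -> u = v.
Proof. by case=> -[|x s] [_ <-]. Qed.

Lemma walkS u v k : is_walk G u v k.+1 -> exists2 w, G u w & is_walk G w v k.
Proof.
case=> -[|w s] [] //= /andP[uw ws] <- [<-].
by exists w => //; exists s.
Qed.

Lemma dist_adj u v : G u v -> is_dist G u v 1.
Proof.
move=> uv; split; first exact: walk_adj.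
by case=> // /walk0 eq_uv; rewrite eq_uv (adj_irr G) in uv.
Qed.

Lemma deg_size u (s : seq V) :
  uniq s -> (forall v, (v \in s) = G u v) -> deg G u = size s.
Proof.
move=> s_uniq sE; rewrite /deg.
have -> : neighbourhood G u = [set` [fset x in s]%fset]%classic.
  by apply/seteqP; split=> v; rewrite /neighbourhood /= in_fset /= sE.
by rewrite set_fsetK card_fseq undup_id.
Qed.

Lemma neighbours_enum u : finite_set (neighbourhood G u) ->
  exists s : seq V, uniq s /\ forall v, (v \in s) = G u v.
Proof.
move=> fin; exists (fset_set (neighbourhood G u)); split=> [|v].
  exact: fset_uniq.
rewrite in_fset_set //; apply/idP/idP; first by rewrite inE.
by move=> uv; rewrite inE.
Qed.

Variables (h p l : nat) (f : V -> nat).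
Hypotheses (le_ph : p <= h) (fP : is_labelling G h p p l f).

Lemma labelling_adj u v : G u v -> h <= `|f u - f v|%N.
Proof. by case: fP => _ _ fd /dist_adj; case: (fd u v). Qed.

(** Only some walk is required: the distance it bounds lies between 1 and 3,
    and [p <= h] makes the three constraints yield [p] uniformly. *)
Lemma labelling_near u v k :
  is_walk G u v k -> k <= 3 -> u != v -> p <= `|f u - f v|%N.
Proof.
case: fP => _ _ fd uvk le_k3 neq_uv.
have [d dP] := ex_minimum uvk; have le_dk := dP.2 _ uvk.
case: (fd u v) => f1 f2 f3.
case: d dP le_dk => [|[|[|[|d]]]] dP le_dk; last by lia.
- by move: neq_uv; rewrite (walk0 dP.1) eqxx.
- exact: leq_trans (f1 dP).
- exact: f2.
- exact: f3.
Qed.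

End Walks.

(** * Lower bounds on the span *)

(** Pigeonhole principle: the quotients by [p] of the values are distinct. *)
Lemma separated_span (T : eqType) (X : seq T) (g : T -> nat) (p l : nat) :
  0 < p -> uniq X ->
  {in X &, forall x y, x != y -> p <= `|g x - g y|%N} ->
  {in X, forall x, g x <= l} -> (size X - 1) * p <= l.
Proof.
move=> p_gt0 X_uniq sep le_l; apply: leq_trans (leq_divM l p).
rewrite leq_mul2r; apply/orP; right.
have q_uniq : uniq [seq g x %/ p | x <- X].
  rewrite map_inj_in_uniq // => x y xX yX /= eq_q.
  apply/eqP; apply: contraT => /(sep x y xX yX).
  have := ltn_pmod (g x) p_gt0; have := ltn_pmod (g y) p_gt0.
  have := divn_eq (g x) p; have := divn_eq (g y) p; rewrite eq_q; lia.
have := uniq_leq_size q_uniq (s2 := iota 0 (l %/ p).+1).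
rewrite size_map size_iota => size_le; rewrite leq_subLR add1n; apply: size_le.
move=> _ /mapP[x xX ->]; rewrite mem_iota /= add0n ltnS.
by apply: leq_div2r; exact: le_l.
Qed.

Section LowerBounds.
Variables (V : countType) (T : graph V) (h p l : nat) (f : V -> nat).
Hypotheses (p_gt0 : 0 < p) (le_ph : p <= h) (fP : is_labelling T h p p l f).

(** The labels around [u] leave a gap of at least [2 * h] about [f u], or
    lie all on one side of it.  Subtracting [h] above [f u] therefore keeps
    them [p] apart, and brings all of them into [0, l - h]. *)
Lemma star_span u (s : seq V) :
  uniq s -> (forall v, (v \in s) = T u v) -> 0 < size s ->
  h + (size s - 1) * p <= l.
Proof.
move=> s_uniq sE s_gt0; have le_l := let: And3 _ le_l _ := fP in le_l.
have far v : v \in s -> h <= `|f u - f v|%N.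
  by rewrite sE; exact: (labelling_adj fP).
have le_hl : h <= l.
  case: s s_gt0 far {s_uniq sE} => // v s _ /(_ v (mem_head _ _)).
  by move=> far_v; move: (le_l u) (le_l v); lia.
rewrite -leq_subRL //.
apply: (@separated_span _ _ (fun v => if f v < f u then f v else f v - h)).
- exact: p_gt0.
- exact: s_uniq.
- move=> x y xs ys neq_xy.
  have xy2 : is_walk T x y 2.
    rewrite sE in xs; rewrite sE in ys.
    exact: walk_cat (walk_rev (walk_adj xs)) (walk_adj ys).
  move: (labelling_near le_ph fP xy2 isT neq_xy) (far x xs) (far y ys) => /=.
  by case: (ltnP (f x)); case: (ltnP (f y)); lia.
- move=> x xs /=; move: (far x xs) (le_l u) (le_l x) => /=.
  by case: (ltnP (f x)); lia.
Qed.

(** Neighbours of [u] and of [v] are joined by a walk of length at most 3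
    through the edge, and a common neighbour would close a triangle. *)
Lemma double_star_span u v (s t : seq V) : is_tree T -> T u v ->
  uniq s -> (forall x, (x \in s) = T u x) ->
  uniq t -> (forall x, (x \in t) = T v x) ->
  (size s + size t - 1) * p <= l.
Proof.
move=> [_ acyclic] uv s_uniq sE t_uniq tE.
have le_l := let: And3 _ le_l _ := fP in le_l.
rewrite -size_cat; apply: (@separated_span _ _ f) => // [|x y].
  rewrite cat_uniq s_uniq t_uniq andbT /=; apply/hasPn => x.
  rewrite tE sE => vx; apply/negP => ux.
  have /acyclic : ucycle T [:: u; v; x]; last by [].
  rewrite /ucycle /= uv vx (adj_sym T x) ux /= !inE negb_or andbT -andbA.
  have neq y z : T y z -> y != z.
    by apply: contraTneq => ->; rewrite (adj_irr T).
  by rewrite !neq.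
have near z : z \in s ++ t -> is_walk T u z 1 \/ is_walk T v z 1.
  by rewrite mem_cat sE tE => /orP[] /walk_adj; [left|right].
have close k : k <= 3 -> is_walk T x y k -> x != y -> p <= `|f x - f y|%N.
  by move=> le_k3 xyk; exact: (labelling_near le_ph fP xyk).
move=> /near[] /walk_rev xw /near[] wy.
- exact: (close 2 isT (walk_cat xw wy)).
- exact: (close 3 isT (walk_cat xw (walk_cat (walk_adj uv) wy))).
- exact: (close 3 isT (walk_cat xw (walk_cat (walk_rev (walk_adj uv)) wy))).
- exact: (close 2 isT (walk_cat xw wy)).
Qed.

End LowerBounds.

(** * Rooted trees *)

(** The second clause contains the acyclicity: every edge is a parent edge.
    The value of [par] at the root is arbitrary. *)
Definition rooting (V : countType) (G : graph V) (r : V) (par : V -> V)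
    (depth : V -> nat) : Prop :=
  (forall v, depth v = if v == r then 0 else (depth (par v)).+1) /\
  (forall u v, G u v =
     ((v != r) && (par v == u)) || ((u != r) && (par u == v))).

(** The depth is the distance to the root, and the parent any neighbour that
    is closer to it.  No other edge can exist, since it would close a cycle
    with parent edges. *)
Lemma tree_rooting (V : countType) (G : graph V) (r : V) :
  is_tree G -> exists par depth, rooting G r par depth.
Proof.
move=> [connected acyclic].
have /choice[depth depthP] : forall v, exists d, is_dist G v r d.
  by move=> v; have [k /ex_minimum] := connected v r.
have depth_r : depth r = 0.
  by apply/eqP; rewrite -leqn0; apply: (depthP r).2; exists [::].
have /choice[par parP] v : exists w, v != r -> G v w /\ depth v = (depth w).+1.
  have [->|v_r] := eqVneq v r; first by exists r.
  have [] := depthP v; case E: (depth v) => [|k] v_walk v_min.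
    by move: v_r; rewrite (walk0 v_walk) eqxx.
  have [w vw w_walk] := walkS v_walk; exists w => _; split=> //; congr _.+1.
  apply/eqP; rewrite eqn_leq ((depthP w).2 _ w_walk) andbT -ltnS.
  exact: v_min _ (walk_cat (walk_adj vw) (depthP w).1).
exists par, depth; split=> [v|u v].
  by have [->//|/parP[]] := eqVneq v r.
apply/idP/orP=> [uv|[] /andP[/parP[Gp _] /eqP <-] //]; last first.
  by rewrite (adj_sym G).
apply: contrapT => not_par.
(* Without the edge [uv], both ends still reach the root by parent edges; a
   simple path between them, closed up by [uv], is a cycle. *)
pose G' x y := G x y && ~~ (((x == u) && (y == v)) || ((x == v) && (y == u))).
have G'_sym x y : G' x y = G' y x.
  by rewrite /G' (adj_sym G) orbC [(x == v) && _]andbC [(x == u) && _]andbC.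
have to_root k x : depth x = k -> exists2 s, path G' x s & last x s = r.
  elim: k x => [|k IHk] x dx; have [->|x_r] := eqVneq x r;
    try by exists [::].
    by have [_] := parP x x_r; rewrite dx.
  have [Gx] := parP x x_r; rewrite dx => -[/esym/IHk[s xs sr]].
  exists (par x :: s) => //=; rewrite xs andbT /G' Gx /=.
  apply/negP => /orP[] /andP[/eqP xE /eqP pE]; apply: not_par.
    by right; rewrite -xE x_r pE eqxx.
  by left; rewrite -xE x_r pE eqxx.
have [s us su] := to_root _ u erefl; have [t vt tv] := to_root _ v erefl.
have : path G' u (s ++ rev (belast v t)).
  rewrite cat_path us su -tv rev_path /=.
  by rewrite (eq_path (e' := G')) // => x y; rewrite G'_sym.
have : last u (s ++ rev (belast v t)) = v.
  rewrite last_cat; case: (t) tv su => [|x t'] /=; first by move=> -> ->.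
  by rewrite rev_cons last_rcons.
move=> + upath; case/shortenP: upath => c Gc c_uniq _ v_last.
have Gc' : path G u c by apply: sub_path Gc => x y /andP[].
have : size (u :: c) <= 2.
  apply: acyclic; rewrite /ucycle c_uniq andbT /= rcons_path Gc' /=.
  by rewrite v_last (adj_sym G).
case: c Gc v_last {c_uniq Gc'} => [|x [|//]] /=.
  by move=> _ eq_uv; move: uv; rewrite eq_uv (adj_irr G).
by rewrite andbT => /andP[_ /negP Gux] eq_xv; case: Gux; rewrite eq_xv !eqxx.
Qed.

Lemma rooting_adj (V : countType) (G : graph V) r par depth u v :
  rooting G r par depth -> G u v -> odd (depth v) = ~~ odd (depth u).
Proof.
move=> [depthE ->] /orP[] /andP[/negPf x_r /eqP <-].
  by rewrite depthE x_r.
by rewrite [in RHS]depthE x_r /= negbK.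
Qed.

(** A tree is bipartite, the parity of the depth being the side. *)
Lemma rooting_walk (V : countType) (G : graph V) r par depth u v k :
  rooting G r par depth -> is_walk G u v k ->
  odd (depth v) = odd (depth u) (+) odd k.
Proof.
move=> rP; elim: k u => [|k IHk] u; first by move/walk0 <-; rewrite addbF.
by case/walkS=> w /(rooting_adj rP) wE /IHk -> /=; rewrite wE addNb addbN.
Qed.

(** * The two-level labelling *)

Section LevelLabelling.
Variables (V : countType) (G : graph V) (r : V) (par : V -> V).
Variables (depth : V -> nat) (nb : V -> seq V) (D h p : nat).
Hypotheses (rP : rooting G r par depth) (p_gt0 : 0 < p) (le_ph : p <= h).
Hypothesis nb_mem : forall u v, (v \in nb u) = G u v.
Hypotheses (D_gt0 : 0 < D) (nb_size : forall u, size (nb u) <= D).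

Definition is_child u v := (v != r) && (par v == u).

Definition children u := [seq v <- nb u | is_child u v].

(** The least label used at odd depth. *)
Definition high := h + (D - 1) * p.

(** The least label allowed next to a vertex labelled [x]. *)
Definition base x := if x < high then high else 0.

(** The children of a vertex are labelled [p] apart, shifted by [p] from the
    label [avoid] of their grandparent onwards. *)
Definition step avoid c := if c < avoid then c else c + p.

(** The label of [v] depends on those of its parent and its grandparent.  The
    recursion is on a bound [k] of the depth.  The children of the root have
    nothing to avoid, which is expressed by avoiding a label too large to be
    reached, [high + D * p]. *)
Fixpoint label_rec k v : nat :=
  if k is k'.+1 then
    if v == r then 0 else
    let u := par v in
    step (if u == r then high + D * p else label_rec k' (par u))
         (base (label_rec k' u) + index v (children u) * p)
  else 0.

Definition label v := label_rec (depth v).+1 v.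

Definition avoided u := if u == r then high + D * p else label (par u).

Lemma depth_par v : v != r -> depth v = (depth (par v)).+1.
Proof. by move=> v_r; rewrite rP.1 (negPf v_r). Qed.

Lemma label_rec_fuel k v : depth v < k -> label_rec k v = label v.
Proof.
rewrite /label; have : depth v < (depth v).+1 by [].
move: {2 4}(depth v).+1 => k'; elim: k k' v => [|k IHk] [|k'] v //= lt1 lt2.
have [//|v_r] := eqVneq v r; rewrite (depth_par v_r) !ltnS in lt1 lt2.
rewrite (IHk k' (par v)) //; have [//|u_r] := eqVneq (par v) r.
by rewrite (IHk k') // ltnW // -depth_par.
Qed.

Lemma label_root : label r = 0.
Proof. by rewrite /label /= eqxx. Qed.

Lemma label_child u v : is_child u v ->
  label v = step (avoided u) (base (label u) + index v (children u) * p).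
Proof.
case/andP=> v_r /eqP <-; rewrite {1}/label /= (negPf v_r) /avoided.
rewrite [label_rec _ (par v)]label_rec_fuel ?(depth_par v_r) //.
by have [//|u_r] := eqVneq (par v) r; rewrite label_rec_fuel // (depth_par u_r).
Qed.

Lemma mem_children u v : (v \in children u) = is_child u v.
Proof.
rewrite mem_filter nb_mem rP.2 andb_idr // => /andP[v_r uv].
by rewrite v_r uv.
Qed.

Lemma is_childE u v : v \in nb u ->
  is_child u v = ~~ ((u != r) && (par u == v)).
Proof.
rewrite nb_mem rP.2 => adj_uv.
apply/idP/idP=> [/andP[v_r /eqP vu]|/negPf not_par].
  apply/negP => /andP[u_r /eqP uv].
  have := depth_par v_r; rewrite vu (depth_par u_r) uv => /eqP.
  by rewrite ltn_eqF // ltnS leqnSn.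
by rewrite not_par orbF in adj_uv.
Qed.

(** Apart from the root, a vertex has a neighbour that is not a child, so its
    children fit into the [D - 1] labels that differ from the avoided one. *)
Lemma size_children u : size (children u) + (u != r) <= D.
Proof.
apply: leq_trans (nb_size u); rewrite -(count_predC (is_child u) (nb u)).
rewrite size_filter leq_add2l; have [//|u_r] := eqVneq u r.
rewrite -has_count; apply/hasP; exists (par u).
  by rewrite nb_mem rP.2 u_r eqxx orbT.
by rewrite /= is_childE ?u_r ?eqxx // nb_mem rP.2 u_r eqxx orbT.
Qed.

(** The heart of the construction: in units of [p], the labels around [u] are
    distinct numbers below [D].  With [g] the slot of the parent of [u], the
    [i]-th child gets slot [bump g i], and [bump g] is an injection that
    misses [g].  At the root [g = D], where [bump g] does not shift. *)
Lemma neighbour_slots u :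
  (u != r -> exists2 g, g < D & label (par u) = base (label u) + g * p) ->
  exists sigma : V -> nat,
    {in nb u &, injective sigma} /\
    {in nb u, forall v,
       sigma v < D /\ label v = base (label u) + sigma v * p}.
Proof.
move=> parP; have [g g_lt avoidE] : exists2 g, (u != r -> g < D) /\
    (u == r -> g = D) & avoided u = base (label u) + g * p.
  rewrite /avoided; have [->|u_r] := eqVneq u r.
    by exists D => //; rewrite label_root /base /high; case: ifP => //; lia.
  by have [g g_lt ->] := parP u_r; exists g.
pose sigma v := if is_child u v then bump g (index v (children u)) else g.
exists sigma; split=> [x y xu yu|v vu].
  rewrite /sigma; case: ifP => cx; case: ifP => cy.
  - move/(can_inj (bumpK g))/(congr1 (nth r (children u))).
    by rewrite !nth_index ?mem_children.
  - by move=> /eqP; rewrite eq_sym (negPf (neq_bump _ _)).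
  - by move=> /eqP; rewrite (negPf (neq_bump _ _)).
  - move=> _; move: cx cy; rewrite !is_childE //.
    by move=> /negbFE/andP[_ /eqP <-] /negbFE/andP[_ /eqP <-].
rewrite /sigma; case: ifP => [cv|].
  have lt_i : index v (children u) < size (children u).
    by rewrite index_mem mem_children.
  have := size_children u; rewrite (label_child cv) /step avoidE /bump.
  rewrite ltn_add2l ltn_pmul2r // [g <= _]leqNgt.
  move: lt_i g_lt; case: eqVneq => /= u_r; set i := index _ _ => lt_i [].
    by move=> _ /(_ isT) ->; case: (ltnP i D) => /=; rewrite ?add0n; lia.
  by move=> /(_ isT) lt_g _; case: (ltnP i g) => /=; rewrite ?mulSn; lia.
rewrite is_childE // => /negbFE/andP[u_r /eqP vE].
split; first exact: g_lt.1.
by rewrite -avoidE /avoided (negPf u_r) vE.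
Qed.

Lemma base_level (b : bool) g : g < D ->
  base (b * high + g * p) = ~~ b * high.
Proof.
move=> lt_g; have : g * p <= (D - 1) * p by apply: leq_mul; lia.
rewrite /base /high; case: b => /= le_g; first by rewrite mul1n ltnNge leq_addr.
by rewrite mul0n mul1n add0n; case: ltnP => //; lia.
Qed.

(** The hypothesis of [neighbour_slots] on the parent is the present claim two
    levels higher, hence the strong induction on the depth. *)
Lemma label_level v :
  exists2 g, g < D & label v = odd (depth v) * high + g * p.
Proof.
have [k] := ubnP (depth v); elim: k v => // k IHk v lt_vk.
have [->|v_r] := eqVneq v r.
  by exists 0 => //; rewrite label_root rP.1 eqxx.
have dE := depth_par v_r; set u := par v in dE.
have uv : v \in nb u by rewrite nb_mem rP.2 v_r eqxx.
have [|gu lt_gu labu] := IHk u; first by rewrite -dE in lt_vk *; lia.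
have bE : base (label u) = ~~ odd (depth u) * high by rewrite labu base_level.
have [u_r|sigma [_ /(_ v uv)]] := @neighbour_slots u.
  have [|g lt_g ->] := IHk (par u).
    by have := depth_par u_r; lia.
  by exists g; rewrite // bE (depth_par u_r) /= negbK.
by rewrite bE => -[lt_s ->]; exists (sigma v); rewrite // dE.
Qed.

Lemma label_siblings u x y : x \in nb u -> y \in nb u -> x != y ->
  p <= `|label x - label y|%N.
Proof.
move=> xu yu neq_xy; have [|sigma [inj sigmaP]] := @neighbour_slots u.
  move=> u_r; have [gu lt_gu ->] := label_level u.
  have [g lt_g ->] := label_level (par u); exists g => //.
  by rewrite base_level // (depth_par u_r) /= negbK.
have [_ ->] := sigmaP x xu; have [_ ->] := sigmaP y yu.
have : sigma x != sigma y by apply: contraNneq neq_xy => /inj ->.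
by rewrite neq_ltn => /orP[] lt_s;
   have := leq_mul lt_s (leqnn p); rewrite mulSn; lia.
Qed.

Lemma label_level_gap x y : odd (depth x) != odd (depth y) ->
  h <= `|label x - label y|%N.
Proof.
have [gx lt_gx ->] := label_level x; have [gy lt_gy ->] := label_level y.
have lex : gx * p <= (D - 1) * p by apply: leq_mul; lia.
have ley : gy * p <= (D - 1) * p by apply: leq_mul; lia.
by rewrite /high; do 2!case: odd => //=; rewrite ?mul1n; lia.
Qed.

Lemma label_elegant :
  is_elegant_labelling G h p p (h + 2 * (D - 1) * p) label.
Proof.
set l := h + _; have lE : l = high + (D - 1) * p by rewrite /l /high; lia.
have le_g g : g < D -> g * p <= (D - 1) * p by move=> lt_g; apply: leq_mul; lia.
have le_l u : label u <= l.
  have [g /le_g gl ->] := label_level u.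
  by rewrite lE; case: odd; rewrite ?mul1n; lia.
split.
  split=> [|//|u v]; first by rewrite addn_gt0 (leq_trans p_gt0 le_ph).
  split=> [[] /(rooting_walk rP) uv _|[uv2 min2]|[] /(rooting_walk rP) uv _].
  - by apply: label_level_gap; rewrite uv; case: odd.
  - have [w uw /walkS[x wx /walk0 eq_xv]] := walkS uv2.
    apply: (@label_siblings w); rewrite ?nb_mem -?eq_xv //.
      by rewrite (adj_sym G).
    apply/eqP => eq_ux; have /min2 // : is_walk G u v 0.
    by exists [::]; rewrite eq_ux.
  - apply: leq_trans le_ph _; apply: label_level_gap.
    by rewrite uv; case: odd.
(* The neighbours of [u] are on the other level: [a u] is its least label. *)
pose a u := ~~ odd (depth u) * high.
exists (fun u => [set k %% l.+1 |
                  k in [set k | a u <= k <= a u + (D - 1) * p]])%classic.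
split=> [u|u _ [v uv <-]|u v uv].
- by exists (a u), (a u + (D - 1) * p); rewrite leq_addr.
- have [g /le_g gl vE] := label_level v; exists (label v).
    by rewrite /= vE (rooting_adj rP uv) /a; lia.
  by rewrite modn_small // ltnS.
- apply/seteqP; split=> // z [[i /= iP <-] [j /= jP]].
  have bound w k : a w <= k <= a w + (D - 1) * p -> k < l.+1.
    by rewrite /a lE; case: odd => /=; rewrite ?mul1n; lia.
  rewrite !modn_small ?(bound _ _ iP) ?(bound _ _ jP) // => eq_ij.
  move: iP jP; rewrite eq_ij /a (rooting_adj rP uv) /high.
  by case: odd => /=; rewrite ?mul1n ?mul0n; lia.
Qed.

End LevelLabelling.

(** * Bounds for trees *)

Section Bounds.
Variables (V : countType) (T : graph V) (h p D : nat).
Hypotheses (p_gt0 : 0 < p) (le_ph : p <= h).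
Hypotheses (treeT : is_tree T) (maxD : is_max_degree T D).

Lemma span_lower_bound D2 l f :
  is_max_edge_degree T D2 -> is_labelling T h p p l f ->
  maxn ((D2 - 1) * p) (h + (D - 1) * p) <= l.
Proof.
case: maxD => fin [[w _ degw] leD].
move=> [[u [v [uv D2E]]] _] fP; rewrite D2E geq_max.
have [s [s_uniq sE]] := neighbours_enum (fin u).
have [t [t_uniq tE]] := neighbours_enum (fin v).
have [x [x_uniq xE]] := neighbours_enum (fin w).
rewrite (deg_size s_uniq sE) (deg_size t_uniq tE).
rewrite (double_star_span p_gt0 le_ph fP treeT uv) //=.
rewrite -degw (deg_size x_uniq xE).
apply: (star_span p_gt0 le_ph fP x_uniq xE).
rewrite -(deg_size x_uniq xE) degw.
apply: (@leq_trans (deg T u)); last by apply: leD; exists u.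
rewrite (deg_size s_uniq sE); move: uv; rewrite -sE.
by case: (s).
Qed.

Lemma elegant_labelling_exists u v : T u v ->
  exists f, is_elegant_labelling T h p p (h + 2 * (D - 1) * p) f.
Proof.
move=> uv; have [par [depth rP]] := tree_rooting u treeT.
case: maxD => fin [_ leD].
have /choice[nb nbP] x := neighbours_enum (fin x).
have nb_size x : size (nb x) <= D.
  by rewrite -(deg_size (nbP x).1 (nbP x).2); apply: leD; exists x.
have D_gt0 : 0 < D.
  apply: leq_trans (nb_size u); move: uv; rewrite -(nbP u).2.
  by case: (nb u).
exists (label u par depth nb D h p).
by apply: label_elegant => // x; have [] := nbP x.
Qed.

Lemma tree_span_bounds D2 : is_max_edge_degree T D2 ->
  exists l ls : nat,
    [/\ is_lambda T h p p l, is_lambda_star T h p p ls,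
        maxn ((D2 - 1) * p) (h + (D - 1) * p) <= l, l <= ls &
        ls <= h + 2 * (D - 1) * p].
Proof.
move=> maxD2; have [[u [v [uv _]]] _] := maxD2.
have [f fP] := elegant_labelling_exists uv.
have elegant : [set l | exists f, is_elegant_labelling T h p p l f]%classic
  (h + 2 * (D - 1) * p) by exists f.
have [ls lsP] := ex_minimum elegant.
have [g [gP _]] := lsP.1.
have plain : [set l | exists f, is_labelling T h p p l f]%classic ls.
  by exists g.
have [l lP] := ex_minimum plain.
exists l, ls; split=> //; first by have [f' /span_lower_bound->] := lP.1.
  exact: lP.2.
exact: lsP.2.
Qed.

End Bounds.

(** * The one-way infinite path *)

Definition consecutive : rel nat := fun i j => (i.+1 == j) || (j.+1 == i).

Lemma consecutive_sym : symmetric consecutive.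
Proof. by move=> i j; rewrite /consecutive orbC. Qed.

Lemma consecutive_irr : irreflexive consecutive.
Proof. by move=> i; rewrite /consecutive; lia. Qed.

Definition ray := Graph consecutive_sym consecutive_irr.

(** Both neighbours on a cycle of its largest vertex would have to be its
    predecessor. *)
Lemma ray_tree : is_tree ray.
Proof.
split=> [i j|c /andP[c_cycle c_uniq]].
  have from0 k : is_walk ray 0 k k.
    elim: k => [|k IHk]; first by exists [::].
    rewrite -addn1; apply: walk_cat IHk _; apply: walk_adj.
    by rewrite /= /consecutive addn1 eqxx.
  by exists (i + j); apply: walk_cat (from0 j); apply: walk_rev.
rewrite leqNgt; apply/negP => lt2c.
have [m mc max_m] : exists2 m, m \in c & {in c, forall i, i <= m}.
  have [||m [mc]] := @ex_maximum [set i | i \in c]%classic (head 0 c) (sumn c).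
  - by case: (c) lt2c => //= a s _; rewrite inE eqxx.
  - move=> j /=; elim: (c) => //= a s IHs.
    by rewrite inE => /orP[/eqP->|/IHs]; lia.
  by move=> max_m; exists m.
have [i s rot_c] := rot_to mc.
rewrite -(size_rot i) rot_c in lt2c.
rewrite -(rot_uniq i) rot_c in c_uniq; rewrite -(rot_cycle i) rot_c in c_cycle.
have {}max_m j : j \in s -> j <= m.
  by move=> js; apply: max_m; rewrite -(mem_rot i) rot_c inE js orbT.
case: s lt2c c_uniq c_cycle max_m {rot_c} => [|a s] /=; first by [].
case/lastP: s => [|s b] lt2c c_uniq; first by [].
rewrite rcons_path last_rcons /consecutive => /and3P[ma _ bm] max_m.
have := max_m a (mem_head _ _).
have : b <= m by apply: max_m; rewrite inE mem_rcons mem_head orbT.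
move=> lebm leam; have eq_ab : a = b by lia.
by move: c_uniq; rewrite eq_ab mem_rcons mem_head /= andbF.
Qed.

Definition ray_neighbours i := if i is j.+1 then [:: j; i.+1] else [:: 1].

Lemma ray_neighboursP i :
  uniq (ray_neighbours i) /\ forall j, (j \in ray_neighbours i) = ray i j.
Proof.
by case: i => [|i]; split=> // *; rewrite /= ?inE ?andbT /consecutive; lia.
Qed.

Lemma ray_deg i : deg ray i = (0 < i).+1.
Proof.
have [s_uniq sE] := ray_neighboursP i; rewrite (deg_size s_uniq sE).
by case: i {s_uniq sE}.
Qed.

Lemma ray_max_degree : is_max_degree ray 2.
Proof.
split=> [i|].
  apply: (@sub_finite_set _ _ [set` ray_neighbours i]%classic).
    by move=> j /=; rewrite (ray_neighboursP i).2.
  exact: finite_seq.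
split=> [|_ [i _ <-]]; first by exists 1; rewrite ?ray_deg.
by rewrite ray_deg; case: (0 < i).
Qed.

Lemma ray_max_edge_degree : is_max_edge_degree ray 4.
Proof.
split; first by exists 1, 2; rewrite !ray_deg.
by move=> _ [i [j [_ ->]]]; rewrite !ray_deg; case: (0 < i); case: (0 < j).
Qed.

Lemma ray_admissible : admissible_tree ray.
Proof.
split; first exact: ray_tree.
by right; split; [exact: infinite_nat | exists 2; exact: ray_max_degree].
Qed.

Lemma ray_lambda : is_lambda ray 1 1 1 3.
Proof.
have [//|//|l [ls [lP _]]] := @tree_span_bounds _ ray 1 1 2 _ _
  ray_tree ray_max_degree 4 ray_max_edge_degree.
by move=> ge3 le_ls ls_le; have -> : 3 = l by lia.
Qed.

(** * The approximation ratio *)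

Section ApproximationRatio.
Local Open Scope ring_scope.
Import Order.TTheory GRing.Theory Num.Theory.

Lemma epsilon_lt1 D D2 : (0 < D)%N -> (D < D2)%N -> epsilon D D2 < 1.
Proof.
move=> D_gt0 lt_D; rewrite /epsilon ltr_pdivrMr ?mul1r ?ltrD2r ?ltr_nat //.
by rewrite subr_gt0 ltr1n; lia.
Qed.

Lemma span_ratio h p D D2 m : (0 < D)%N -> (D < D2)%N ->
  (maxn ((D2 - 1) * p) (h + (D - 1) * p) <= m)%N ->
  (h + 2 * (D - 1) * p)%N%:R <= (1 + epsilon D D2) * m%:R :> rat.
Proof.
move=> D_gt0 lt_D; rewrite geq_max => /andP[le1 le2].
have -> : (h + 2 * (D - 1) * p = (h + (D - 1) * p) + (D - 1) * p)%N by lia.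
rewrite natrD mulrDl mul1r lerD ?ler_nat //.
have D2_gt0 : (0 : rat) < D2%:R - 1 by rewrite subr_gt0 ltr1n; lia.
have predE k : (0 < k)%N -> k%:R - 1 = (k - 1)%:R :> rat.
  by move=> k_gt0; rewrite natrB.
rewrite /epsilon mulrAC ler_pdivlMr // !predE //; last by lia.
rewrite -!natrM ler_nat -mulnA [(p * _)%N]mulnC.
by rewrite leq_mul.
Qed.

End ApproximationRatio.

(** * Total correctness of programs, with running time *)

Section Programs.
Variable W : nat.

Fixpoint value (s : store) (e : expr) : nat :=
  match e with
  | Const k => k
  | Get a e1 => s a (value s e1)
  | Add e1 e2 => value s e1 + value s e2
  | Sub e1 e2 => value s e1 - value s e2
  end.

(** Overflow is the only way in which an evaluation can fail. *)
Fixpoint fits (s : store) (e : expr) : bool :=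
  match e with
  | Const k => (k <= W)%N
  | Get a e1 => fits s e1 && (s a (value s e1) <= W)
  | Add e1 e2 => [&& fits s e1, fits s e2 & value s e1 + value s e2 <= W]
  | Sub e1 e2 => fits s e1 && fits s e2
  end.

Lemma fits_value s e : fits s e -> value s e <= W.
Proof.
elim: e => [k|a e1 _|e1 _ e2 _|e1 IH1 e2 _] //=; first by case/andP.
  by case/and3P.
by case/andP=> /IH1 le_W _; exact: leq_trans (leq_subr _ _) le_W.
Qed.

Lemma evalE s e : fits s e -> eval W s e = Some (value s e).
Proof.
have wordE k : k <= W -> word W k = Some k by rewrite /word => ->.
elim: e => [k|a e1 IH1|e1 IH1 e2 IH2|e1 IH1 e2 IH2] /=.
- exact: wordE.
- by case/andP=> /IH1 -> /wordE.
- by case/and3P=> /IH1 -> /IH2 -> /wordE.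
- move=> fit; case/andP: (fit) => /IH1 -> /IH2 -> /=.
  exact/wordE/(@fits_value s (Sub e1 e2)).
Qed.

(** Weakest preconditions of programs without loops; loops are left to
    [runs_while]. *)
Fixpoint wp (c : cmd) (Q : store -> Prop) (s : store) : Prop :=
  match c with
  | Skip => Q s
  | Write a ei ev =>
      [/\ fits s ei, fits s ev & Q (update s a (value s ei) (value s ev))]
  | Seq c1 c2 => wp c1 (wp c2 Q) s
  | If e c1 c2 =>
      [/\ fits s e, 0 < value s e -> wp c1 Q s & value s e = 0 -> wp c2 Q s]
  | While _ _ => False
  end.

Fixpoint max_time (c : cmd) : nat :=
  match c with
  | Skip => 1
  | Write _ ei ev => (cost ei + cost ev).+1
  | Seq c1 c2 => max_time c1 + max_time c2
  | If e c1 c2 => (cost e + maxn (max_time c1) (max_time c2)).+1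
  | While _ _ => 0
  end.

Definition runs (c : cmd) (s : store) (t : nat) (Q : store -> Prop) : Prop :=
  exists t' s', [/\ exec W c s t' s', t' <= t & Q s'].

Lemma runs_wp c Q s : wp c Q s -> runs c s (max_time c) Q.
Proof.
elim: c Q s => [|a ei ev|c1 IH1 c2 IH2|e c1 IH1 c2 IH2|//] Q s /=.
- by move=> Qs; exists 1, s; split=> //; constructor.
- case=> /evalE ei_val /evalE ev_val Qs'; eexists; eexists.
  by split; [apply: ExecSet ei_val ev_val | | exact: Qs'].
- move=> /IH1[t1 [s1 [run1 le1 /IH2[t2 [s2 [run2 le2 Qs2]]]]]].
  exists (t1 + t2), s2; split=> //; last exact: leq_add.
  exact: ExecSeq run1 run2.
- case=> /evalE e_val; case: (value s e) e_val => [|x] e_val wp1 wp2.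
    have [t [s' [run le_t Qs']]] := IH2 _ _ (wp2 erefl).
    exists (cost e + t).+1, s'; split=> //; first exact: ExecIfFalse.
    by rewrite ltnS leq_add2l leq_max le_t orbT.
  have [t [s' [run le_t Qs']]] := IH1 _ _ (wp1 isT).
  exists (cost e + t).+1, s'; split=> //; first exact: ExecIfTrue e_val run.
  by rewrite ltnS leq_add2l leq_max le_t.
Qed.

Lemma runs_seq c1 c2 s t1 t2 Q R : runs c1 s t1 Q ->
  (forall s', Q s' -> runs c2 s' t2 R) -> runs (Seq c1 c2) s (t1 + t2) R.
Proof.
move=> [t1' [s1 [run1 le1 Qs1]]] /(_ _ Qs1)[t2' [s2 [run2 le2 Rs2]]].
exists (t1' + t2'), s2; split=> //; last exact: leq_add.
exact: ExecSeq run1 run2.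
Qed.

(** The index [k] of the invariant bounds the number of iterations to come. *)
Lemma runs_while e c (Inv : nat -> store -> Prop) :
  (forall k s, Inv k s -> fits s e /\
     (0 < value s e -> wp c (fun s' => exists2 k', k' < k & Inv k' s') s)) ->
  forall k s, Inv k s ->
  runs (While e c) s (k.+1 * (cost e + max_time c).+1)
    (fun s' => (exists k', Inv k' s') /\ value s' e = 0).
Proof.
move=> step k; elim/ltn_ind: k => k IHk s Is.
have [/evalE e_val] := step k s Is; case E: (value s e) => [|x] in e_val *.
  move=> _; exists (cost e).+1, s; split; first exact: ExecWhileDone.
    by rewrite mulSn -addSn -addnA leq_addr.
  by split=> //; exists k.
move=> /(_ isT)/runs_wp[t1 [s1 [run1 le1 [k' lt_k' Is1]]]].
have [t2 [s2 [run2 le2 post]]] := IHk k' lt_k' s1 Is1.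
exists (cost e + t1 + t2).+1, s2; split=> //.
  exact: ExecWhileStep e_val run1 run2.
rewrite mulSn -addSn leq_add ?ltnS ?leq_add2l //.
by apply: leq_trans le2 _; rewrite leq_mul2r lt_k' orbT.
Qed.

End Programs.

(** * The labelling program *)

Definition var a := Get a (Const 0).
Definition set_var a e := Write a (Const 0) e.

Fixpoint times k e := if k is k'.+1 then Add (times k' e) e else Const 0.

Lemma value_times s k e : value s (times k e) = k * value s e.
Proof. by elim: k => //= k ->; rewrite mulSn addnC. Qed.

Lemma fits_times W s k e :
  fits W s e -> k * value s e <= W -> fits W s (times k e).
Proof.
move=> fit; elim: k => //= k IHk le_W.
rewrite fit value_times -mulSnr le_W andbT IHk //.
by apply: leq_trans le_W; rewrite leq_mul2r leqnSn orbT.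
Qed.

(* Array 4 is the queue of the search.  Array 5 holds parents.  The others hold
   single numbers: the maximum degree, the positions in the queue of the vertex
   being explored and of the first free entry, the position in array 2 of the
   next neighbour to be examined, the label of the next child before [step] is
   applied, the least label of odd depth, and a loop index. *)
Notation a_size := 0 (only parsing).
Notation a_offset := 1 (only parsing).
Notation a_entry := 2 (only parsing).
Notation a_label := 3 (only parsing).
Notation a_queue := 4 (only parsing).
Notation a_parent := 5 (only parsing).
Notation a_degree := 6 (only parsing).
Notation a_head := 7 (only parsing).
Notation a_tail := 8 (only parsing).
Notation a_pos := 9 (only parsing).
Notation a_next := 10 (only parsing).
Notation a_high := 11 (only parsing).
Notation a_index := 12 (only parsing).

Definition row_end u := Get a_offset (Add u (Const 1)).

Definition degree_body : cmd :=
  let d := Sub (row_end (var a_index)) (Get a_offset (var a_index)) in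
  Seq (If (Sub d (var a_degree)) (set_var a_degree d) Skip)
      (set_var a_index (Add (var a_index) (Const 1))).

Definition degree_test : expr := Sub (var a_size) (var a_index).

(** The size [n] of the graph is not a vertex.  As the parent of the root it
    differs from all neighbours, and its entry in the array of labels can hold
    the number to be avoided by the children of the root.  That the root 0 is
    at the head of the queue and has label 0 requires no instruction, as
    entries are 0 by default. *)
Definition search_init (h p : nat) : cmd :=
  Seq (set_var a_high
         (Add (Const h) (times p (Sub (var a_degree) (Const 1)))))
 (Seq (Write a_label (var a_size)
         (Add (var a_high) (times p (var a_degree))))
 (Seq (Write a_parent (Const 0) (var a_size))
 (Seq (set_var a_tail (Const 1))
      (set_var a_next (var a_high))))).

Definition search_test : expr := Sub (var a_tail) (var a_head).

Definition current := Get a_queue (var a_head).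
Definition neighbour := Get a_entry (var a_pos).

Definition label_neighbour (p : nat) : cmd :=
  If (Sub (Get a_label (Get a_parent current)) (var a_next))
    (Write a_label neighbour (var a_next))
    (Write a_label neighbour (Add (var a_next) (Const p))).

Definition enqueue_neighbour (p : nat) : cmd :=
  Seq (Write a_parent neighbour current)
 (Seq (Write a_queue (var a_tail) neighbour)
 (Seq (set_var a_tail (Add (var a_tail) (Const 1)))
      (set_var a_next (Add (var a_next) (Const p))))).

Definition next_vertex : cmd :=
  Seq (set_var a_head (Add (var a_head) (Const 1)))
 (Seq (set_var a_pos (Get a_offset current))
      (If (Sub (var a_high) (Get a_label current))
        (set_var a_next (var a_high))
        (set_var a_next (Const 0)))).

Definition search_body (p : nat) : cmd :=
  let parent := Get a_parent current in
  If (Sub (row_end current) (var a_pos))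
    (Seq (If (Add (Sub neighbour parent) (Sub parent neighbour))
            (Seq (label_neighbour p) (enqueue_neighbour p))
            Skip)
         (set_var a_pos (Add (var a_pos) (Const 1))))
    next_vertex.

Definition tree_labelling (h p : nat) : cmd :=
  Seq (While degree_test degree_body)
 (Seq (search_init h p)
      (While search_test (search_body p))).

(** * The input *)

Lemma flatten_split (T : Type) (ss : seq (seq T)) i : i < size ss ->
  exists a b, flatten ss = a ++ nth [::] ss i ++ b /\
              size a = sumn (take i (shape ss)).
Proof.
move=> lt_i; exists (flatten (take i ss)), (flatten (drop i.+1 ss)); split.
  by rewrite -[in LHS](cat_take_drop i ss) flatten_cat (drop_nth [::] lt_i).
by rewrite size_flatten /shape map_take.
Qed.

Section Input.
Variables (n : nat) (nb : 'I_n -> seq 'I_n).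

Local Notation lists := [seq nb u | u <- enum 'I_n].

Definition offset i := sumn (take i (shape lists)).

Lemma size_lists : size lists = n.
Proof. by rewrite size_map size_enum_ord. Qed.

Lemma size_shape : size (shape lists) = n.
Proof. by rewrite size_map size_lists. Qed.

Lemma nth_lists (u : 'I_n) : nth [::] lists u = nb u.
Proof. by rewrite (nth_map u) ?size_enum_ord // nth_ord_enum. Qed.

Lemma offsetS (u : 'I_n) : offset u.+1 = offset u + size (nb u).
Proof.
have lt_u : u < size (shape lists) by rewrite size_shape.
rewrite /offset (take_nth 0 lt_u) sumn_rcons; congr (_ + _).
by rewrite (nth_map [::]) ?size_lists // nth_lists.
Qed.

Lemma offset_le i : offset i <= \sum_(u < n) size (nb u).
Proof.
have -> : \sum_(u < n) size (nb u) = sumn (shape lists).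
  by rewrite sumnE /shape 2!big_map big_enum.
by rewrite -[in leqRHS](cat_take_drop i (shape _)) sumn_cat leq_addr.
Qed.

Lemma input_offset i : i <= n -> input nb a_offset i = offset i.
Proof. by move=> le_in; rewrite /input /= nth_mkseq. Qed.

Lemma input_entry (u : 'I_n) j x0 : j < size (nb u) ->
  input nb a_entry (offset u + j) = nth x0 (nb u) j.
Proof.
move=> lt_j; rewrite /input /=.
have lt_u : u < size lists by rewrite size_lists.
have [a [b [-> size_a]]] := flatten_split lt_u; rewrite nth_lists.
rewrite !map_cat nth_cat size_map size_a -/(offset u) ltnNge leq_addr /=.
by rewrite addKn nth_cat size_map lt_j (nth_map x0).
Qed.

Lemma input_offset_le i : input nb a_offset i <= \sum_(u < n) size (nb u).
Proof.
have [le_in|lt_ni] := leqP i n; first by rewrite input_offset ?offset_le.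
by rewrite /input nth_default // size_mkseq.
Qed.

End Input.

Lemma leq_sum_uniq (I : finType) (s : seq I) (F : I -> nat) :
  uniq s -> \sum_(x <- s) F x <= \sum_x F x.
Proof.
move=> s_uniq; rewrite big_uniq //= [leqRHS](bigID (mem s)) /=.
exact: leq_addr.
Qed.

(** A neighbour of [u] is its parent or has [u] as its parent, and each of the
    two possibilities accounts for at most [n] pairs. *)
Lemma tree_degree_sum n (T : graph 'I_n) r par depth (nb : 'I_n -> seq 'I_n) :
  rooting T r par depth -> (forall u, uniq (nb u)) ->
  (forall u v, (v \in nb u) = T u v) ->
  \sum_(u < n) size (nb u) <= 2 * n.
Proof.
move=> rP nb_uniq nb_mem.
have one (I : finType) (a : I) : \sum_i (a == i) = 1.
  by rewrite (bigD1 a) //= eqxx big1 // => i; rewrite eq_sym => /negPf ->.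
apply: (@leq_trans (\sum_(u < n) \sum_(v < n) ((par v == u) + (par u == v)))).
  apply: leq_sum => u _.
  rewrite -(card_uniqP (nb_uniq u)) -sum1_card big_mkcond /=.
  apply: leq_sum => v _; rewrite nb_mem rP.2.
  by case: (v != r); case: (u != r); case: (par v == u); case: (par u == v).
under eq_bigr do rewrite big_split one /=.
rewrite big_split exchange_big /=; under eq_bigr do rewrite one.
by rewrite !sum_nat_const card_ord; lia.
Qed.

(** * Breadth-first search *)

Section Search.
Variables (m h p : nat).
Local Notation n := m.+1.
Variables (T : graph 'I_n) (par : 'I_n -> 'I_n) (depth : 'I_n -> nat).
Variable nb : 'I_n -> seq 'I_n.
Local Notation root := (ord0 : 'I_n).
Hypotheses (rP : rooting T root par depth) (p_gt0 : 0 < p) (le_ph : p <= h).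
Hypotheses (nb_uniq : forall u, uniq (nb u)).
Hypotheses (nb_mem : forall u v, (v \in nb u) = T u v).

Definition max_size := \max_(u < n) size (nb u).
Local Notation D := max_size.
Hypothesis D_gt0 : 0 < D.

Local Notation lab := (label root par depth nb D h p).
Local Notation top := (high D h p + D * p).
Local Notation child := (is_child root par).

Lemma nb_size u : size (nb u) <= D.
Proof. exact: (leq_bigmax u). Qed.

(** [Q] lists the vertices reached so far.  Those before position [head] have
    been left, and of the vertex at position [head] the first [j] neighbours
    have been examined.  When [head] is the size of [Q], [nth] falls back to
    the root; this agrees with the queue array, which holds 0 there.  The
    equation for [k] charges each vertex one step per neighbour, and one for
    leaving it. *)
Record searching (Q : seq 'I_n) (head j k : nat) : Prop := Searching {
  queue_uniq : uniq Q;
  head_le : head <= size Q;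
  pos_le : j <= size (nb (nth root Q head));
  queue_mem : forall x, (x \in Q) = (x == root) || (x != root) &&
     ((par x \in take head Q) ||
      (par x == nth root Q head) && (x \in take j (nb (nth root Q head))));
  time_left : k + \sum_(x <- take head Q) (size (nb x)).+1 + j =
     \sum_x (size (nb x)).+1
}.

Section Step.
Variables (Q : seq 'I_n) (head j k : nat).
Hypothesis SQ : searching Q head j k.
Hypothesis lt_head : head < size Q.
Local Notation u := (nth root Q head).

Lemma time_left_gt0 : 0 < k.
Proof.
have := leq_sum_uniq (fun x => (size (nb x)).+1)
  (take_uniq head.+1 (queue_uniq SQ)).
rewrite (take_nth root lt_head) big_rcons /= -(time_left SQ) /=.
have := pos_le SQ; lia.
Qed.

Lemma search_next : j = size (nb u) -> searching Q head.+1 0 k.-1.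
Proof.
move=> jE; split=> [|||x|]; rewrite ?take0 //; first exact: queue_uniq SQ.
- rewrite (queue_mem SQ) jE take_size (take_nth root lt_head) mem_rcons inE.
  rewrite in_nil andbF orbF; case: eqVneq => //= x_r.
  case: eqVneq => [pE|] /=; last by rewrite orbF.
  by rewrite nb_mem rP.2 x_r pE eqxx orbT.
- rewrite -(time_left SQ) (take_nth root lt_head) big_rcons /= jE.
  by have := time_left_gt0; lia.
Qed.

Hypothesis lt_j : j < size (nb u).
Local Notation v := (nth root (nb u) j).

Lemma v_nb : v \in nb u. Proof. exact: mem_nth. Qed.

Lemma search_skip : ~~ child u v -> searching Q head j.+1 k.-1.
Proof.
move=> not_child.
split=> // [||x|]; [exact: queue_uniq SQ|exact: head_le SQ| |].
- rewrite (queue_mem SQ) (take_nth root lt_j) mem_rcons inE.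
  have [->|//] := eqVneq x v; move: not_child; rewrite /is_child.
  by case: eqVneq => //= _ /negPf ->; rewrite orbF.
- by rewrite -(time_left SQ); have := time_left_gt0; lia.
Qed.

(** A vertex enters the queue only from its parent, and only once, because
    neither the queue nor the list of neighbours has repetitions. *)
Lemma v_notin_queue : child u v -> v \notin Q.
Proof.
case/andP=> v_r /eqP pE; rewrite (queue_mem SQ) (negPf v_r) /= pE eqxx /=.
rewrite negb_or; apply/andP; split.
  by rewrite in_take_leq ?index_uniq ?ltnn ?(queue_uniq SQ) // ltnW.
by rewrite in_take_leq ?index_uniq ?ltnn // ltnW.
Qed.

Lemma search_push : child u v -> searching (rcons Q v) head j.+1 k.-1.
Proof.
move=> cv; have := v_notin_queue cv.
have nthE : nth root (rcons Q v) head = u by rewrite nth_rcons lt_head.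
have takeE : take head (rcons Q v) = take head Q.
  by rewrite -cats1 takel_cat // ltnW.
move=> vQ; split=> [|||x|]; rewrite ?nthE ?takeE //.
- by rewrite rcons_uniq vQ (queue_uniq SQ).
- by rewrite size_rcons ltnW // ltnW.
- rewrite (take_nth root lt_j) !mem_rcons !inE (queue_mem SQ).
  have [->|//] := eqVneq x v.
  by case/andP: cv => -> ->; rewrite /= !orbT.
- by rewrite -(time_left SQ); have := time_left_gt0; lia.
Qed.

End Step.

(** By induction on the depth: all parents of vertices in a completely explored
    queue have been left. *)
Lemma search_done Q head j k : searching Q head j k -> size Q <= head ->
  forall x, x \in Q.
Proof.
move=> SQ le_head x; have [d] := ubnP (depth x).
elim: d x => // d IHd x lt_d; rewrite (queue_mem SQ).
have [//|x_r] := eqVneq x root; rewrite take_oversize // IHd //.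
by rewrite (depth_par rP x_r) in lt_d.
Qed.

Definition sentinel_parent x : nat := if x == root then n else par x.

(** The queue array is described at all indices, because leaving the last vertex
    makes the program read the entry after the end of the queue. *)
Record represents (s : store) (Q : seq 'I_n) (head j : nat) : Prop :=
  Represents {
  st_size : s a_size 0 = n;
  st_offset : forall i, s a_offset i = input nb a_offset i;
  st_entry : forall i, s a_entry i = input nb a_entry i;
  st_high : s a_high 0 = high D h p;
  st_queue : forall i, s a_queue i = nth 0 [seq val x | x <- Q] i;
  st_head : s a_head 0 = head;
  st_tail : s a_tail 0 = size Q;
  st_pos : s a_pos 0 = offset nb (nth root Q head) + j;
  st_next : s a_next 0 = base D h p (lab (nth root Q head)) +
     count (child (nth root Q head)) (take j (nb (nth root Q head))) * p;
  st_parent : forall x, x \in Q -> s a_parent x = sentinel_parent x;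
  st_label : forall x, x \in Q -> s a_label x = lab x;
  st_sentinel : s a_label n = top
}.

Variable W : nat.
Hypotheses (W_n : 2 * n < W) (W_top : top <= W).


Lemma degree_sum_le : \sum_(x < n) size (nb x) <= 2 * n.
Proof. exact: tree_degree_sum rP nb_uniq nb_mem. Qed.

Lemma st_offset_le s Q head j i : represents s Q head j ->
  s a_offset i <= W.
Proof.
move=> RQ; rewrite (st_offset RQ); apply: leq_trans (ltnW W_n).
exact: leq_trans (input_offset_le _ _) degree_sum_le.
Qed.

Lemma label_le x : lab x <= top.
Proof.
have [g lt_g ->] := label_level rP p_gt0 le_ph nb_mem D_gt0 nb_size x.
have : g * p <= D * p by rewrite leq_mul2r ltnW ?orbT.
by case: odd; rewrite ?mul1n; lia.
Qed.

Lemma size_queue (Q : seq 'I_n) : uniq Q -> size Q <= n.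
Proof. by move=> /card_uniqP <-; rewrite -[leqRHS]card_ord max_card. Qed.

Definition search_inv k s :=
  exists Q head j, searching Q head j k /\ represents s Q head j.

Section Body.
Variables (Q : seq 'I_n) (head j k : nat) (s : store).
Hypotheses (SQ : searching Q head j k) (RQ : represents s Q head j).

Lemma st_queue_head : s a_queue (s a_head 0) = nth root Q head.
Proof.
rewrite (st_queue RQ) (st_head RQ); have [lt|le] := ltnP head (size Q).
  by rewrite (nth_map root).
by rewrite !nth_default // size_map.
Qed.

Lemma search_test_fits : fits W s search_test.
Proof.
rewrite /= (st_head RQ) (st_tail RQ).
by have := size_queue (queue_uniq SQ); have := head_le SQ; lia.
Qed.

Hypothesis lt_head : head < size Q.
Local Notation u := (nth root Q head).

Lemma uQ : u \in Q. Proof. exact: mem_nth. Qed.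

Lemma st_current_parent : s a_parent u = sentinel_parent u.
Proof. exact: (st_parent RQ uQ). Qed.

Lemma sentinel_parent_le x : sentinel_parent x <= n.
Proof. by rewrite /sentinel_parent; case: ifP => // _; apply: ltnW. Qed.

Lemma st_avoided : s a_label (s a_parent u) = avoided root par depth nb D h p u.
Proof.
rewrite st_current_parent /sentinel_parent /avoided.
have [_|u_r] := eqVneq u root; first exact: (st_sentinel RQ).
apply: (st_label RQ); have := uQ; rewrite {1}(queue_mem SQ u) (negPf u_r) /=.
by case/orP=> [/mem_take//|/andP[/eqP-> _]]; exact: uQ.
Qed.

Lemma st_offset_end : s a_offset (u + 1) = offset nb u + size (nb u).
Proof. by rewrite addn1 (st_offset RQ) input_offset ?offsetS // ltn_ord. Qed.

Hypothesis k_gt0 : 0 < k.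
Local Notation post := (fun s' => exists2 k', k' < k & search_inv k' s').

Lemma next_vertex_step : j = size (nb u) -> wp W next_vertex post s.
Proof.
move=> jE; have size_Q := size_queue (queue_uniq SQ).
have SQ' := search_next SQ lt_head jE.
set w := nth root Q head.+1.
have wE : s a_queue (head + 1) = w.
  rewrite addn1 (st_queue RQ) /w; have [lt|le] := ltnP head.+1 (size Q).
    by rewrite (nth_map root).
  by rewrite !nth_default // size_map.
have labE : s a_label w = lab w.
  apply: (st_label RQ); rewrite /w; have [lt|le] := ltnP head.+1 (size Q).
    exact: mem_nth.
  by rewrite nth_default // (queue_mem SQ) eqxx.
have w_lt : w < n by [].
have lab_W : lab w <= W := leq_trans (label_le w) W_top.
have offW := st_offset_le w RQ.
have done_w t : t = base D h p (lab w) ->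
  post (update (update (update s a_head 0 (head + 1)) a_pos 0
    (s a_offset w)) a_next 0 t).
  move=> tE; exists k.-1; first by lia.
  exists Q, head.+1, 0; split=> //.
  split; rewrite /update /= ?addn1 ?take0 ?addn0 //; try by case: RQ.
  by rewrite (st_offset RQ) input_offset // ltnW.
rewrite /next_vertex /= /update /= (st_head RQ) wE labE (st_high RQ).
split; [lia|lia|split; [lia|lia|split; [lia| |]]] => [lt|ge].
  split; [lia|lia|].
  have := done_w (high D h p); rewrite /update; apply; rewrite /base.
  by rewrite -subn_gt0 lt.
split; [lia|lia|].
have := done_w 0; rewrite /update; apply; rewrite /base.
by move/eqP: ge; rewrite subn_eq0 leqNgt => /negPf ->.
Qed.

Section Neighbour.
Hypothesis lt_j : j < size (nb u).
Local Notation v := (nth root (nb u) j).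

Lemma st_neighbour : s a_entry (s a_pos 0) = v.
Proof. by rewrite (st_pos RQ) (st_entry RQ) (input_entry root). Qed.

Lemma neighbour_is_child : child u v = (s a_parent u != v).
Proof.
rewrite (is_childE rP nb_mem (v_nb lt_j)) st_current_parent /sentinel_parent.
have [_|_] := eqVneq u root; last by [].
by apply/esym; rewrite gtn_eqF.
Qed.

Lemma neighbour_skip_step : ~~ child u v ->
  wp W (set_var a_pos (Add (var a_pos) (Const 1))) post s.
Proof.
move=> not_child.
have := st_offset_le (u + 1) RQ; rewrite st_offset_end => W_end.
split=> //=; first by rewrite (st_pos RQ); lia.
exists k.-1; first by lia.
exists Q, head, j.+1; split; first exact: search_skip.
case: RQ => *; split=> //; rewrite /update /=; first by lia.
rewrite (take_nth root lt_j) -cats1 count_cat /= (negPf not_child).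
by rewrite !addn0.
Qed.

(** The counter [a_next] has advanced once for each child among the neighbours
    already examined, and these are the children listed before [v]. *)
Lemma st_next_child : child u v ->
  s a_next 0 = base D h p (lab u) + index v (children root par nb u) * p.
Proof.
move=> cv; rewrite (st_next RQ) -size_filter; congr (_ + _ * p).
have -> : children root par nb u = filter (child u) (take j (nb u)) ++
    v :: filter (child u) (drop j.+1 (nb u)).
  rewrite /children -[in LHS](cat_take_drop j (nb u)) (drop_nth root lt_j).
  by rewrite filter_cat /= cv.
rewrite index_cat mem_filter cv /= in_take_leq ?index_uniq ?ltnn // 1?ltnW //.
by rewrite eqxx addn0.
Qed.

Lemma st_next_le : child u v -> s a_next 0 + p <= top.
Proof.
move=> cv; have := size_children rP nb_mem nb_size u.
have := cv; rewrite -(mem_children rP nb_mem) -index_mem.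
rewrite (st_next_child cv); set i := index _ _ => lt_i le_D.
have : i.+1 * p <= D * p by rewrite leq_mul2r; apply/orP; right; lia.
by rewrite mulSn /base; case: ifP; lia.
Qed.

(** Stated for any [t] equal to the label of [v], as the two branches of
    [label_neighbour] arrive at it by different expressions. *)
Lemma enqueue_step t : child u v -> t = lab v ->
  wp W (Seq (enqueue_neighbour p) (set_var a_pos (Add (var a_pos) (Const 1))))
    post (update s a_label v t).
Proof.
move=> cv ->; have uE := st_queue_head; have n_W : n < W by lia.
have SQ' := search_push SQ lt_head lt_j cv.
have size_Q := size_queue (queue_uniq SQ'); rewrite size_rcons in size_Q.
have := st_offset_le (u + 1) RQ; rewrite st_offset_end => W_end.
have next_le := st_next_le cv.
have posE := st_pos RQ; have vE := st_neighbour; rewrite posE in vE.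
have v_lt : v < n by [].
have u_lt : u < n by [].
rewrite /= /update /= posE vE uE (st_head RQ) (st_tail RQ).
split; [lia|lia|split; [lia|lia|split; [lia|lia|split; [lia|lia|]]]].
split; [lia|lia|exists k.-1; first by lia].
exists (rcons Q v), head, j.+1; split=> //; have [v_r par_v] := andP cv.
have nthE : nth root (rcons Q v) head = u by rewrite nth_rcons lt_head.
split; rewrite /= ?nthE ?size_rcons ?addn1 //; try by case: RQ.
- move=> i; rewrite map_rcons nth_rcons size_map (st_queue RQ).
  by case: ltngtP => // lt; rewrite nth_default // size_map ltnW.
- by rewrite addnS.
- rewrite (take_nth root lt_j) -cats1 count_cat /= cv addn0 mulnDl mul1n addnA.
  by rewrite -(st_next RQ).
- move=> x; rewrite mem_rcons inE val_eqE; have [-> _|_ /= xQ] := eqVneq x v.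
    by rewrite /sentinel_parent (negPf v_r) (eqP par_v).
  exact: (st_parent RQ).
- move=> x; rewrite mem_rcons inE val_eqE; have [-> //|_ /= xQ] := eqVneq x v.
  exact: (st_label RQ).
- by rewrite gtn_eqF ?(st_sentinel RQ).
Qed.

End Neighbour.

Lemma search_body_step : wp W (search_body p) post s.
Proof.
have uE := st_queue_head; have n_W : n < W by lia.
have size_Q := size_queue (queue_uniq SQ).
have offW i := st_offset_le i RQ.
have endE := st_offset_end; have offuW := offW (u + 1); rewrite endE in offuW.
have parW : s a_parent u < W.
  by rewrite st_current_parent; apply: leq_ltn_trans (sentinel_parent_le u) _.
have posE := st_pos RQ; have le_j := pos_le SQ.
have uW : u + 1 <= n by rewrite addn1.
rewrite /search_body; split.
- rewrite /= uE endE posE (st_head RQ); lia.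
- rewrite /= uE endE posE => lt_pos; have lt_j : j < size (nb u) by lia.
  have entE := st_neighbour lt_j; have childE := neighbour_is_child lt_j.
  have lt_v : nth root (nb u) j < n by [].
  rewrite posE in entE.
  split; rewrite /= ?uE ?posE ?entE ?(st_head RQ); first lia.
    move=> ne; have cv : child u (nth root (nb u) j) by rewrite childE; lia.
    have next_le := st_next_le lt_j cv.
    have labv : avoided root par depth nb D h p u <= W.
      apply: leq_trans W_top; rewrite /avoided.
      by case: ifP => // _; exact: label_le.
    have lt_u : u < n by [].
    split; rewrite /= ?uE ?posE ?entE ?(st_head RQ) ?st_avoided.
    - lia.
    - move=> lt_avoid; split; [lia|lia|].
      apply: enqueue_step => //.
      rewrite (label_child _ _ _ _ rP cv) /step -st_next_child //.
      by move: lt_avoid; rewrite subn_gt0 => ->.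
    - move=> ge_avoid; split; [lia|lia|].
      apply: enqueue_step => //.
      rewrite (label_child _ _ _ _ rP cv) /step -st_next_child //.
      by move/eqP: ge_avoid; rewrite subn_eq0 leqNgt => /negPf ->.
  move=> eq0; rewrite -posE; apply: (neighbour_skip_step lt_j).
  rewrite childE; lia.
- rewrite /= uE endE posE => pos_end; apply: next_vertex_step; lia.
Qed.

End Body.

Lemma base_label_root : base D h p (lab root) = high D h p.
Proof. by rewrite label_root /base /high addn_gt0 (leq_trans p_gt0 le_ph). Qed.

Definition vertex_degree i := offset nb i.+1 - offset nb i.

Lemma max_size_nat : D = \max_(0 <= i < n) vertex_degree i.
Proof.
rewrite big_mkord; apply: eq_bigr => u _.
by rewrite /vertex_degree offsetS addKn.
Qed.

(** The first loop writes to two arrays only. *)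
Definition unchanged (s : store) :=
  forall a i, a != a_degree -> a != a_index -> s a i = input nb a i.

Definition degree_inv k s :=
  exists i, [/\ i + k = n, s a_index 0 = i,
    s a_degree 0 = \max_(0 <= x < i) vertex_degree x & unchanged s].

Lemma input_offset_W i : input nb a_offset i <= W.
Proof.
apply: leq_trans (ltnW W_n).
exact: leq_trans (input_offset_le _ _) degree_sum_le.
Qed.

Lemma degree_step k s : degree_inv k s -> fits W s degree_test /\
  (0 < value s degree_test ->
   wp W degree_body (fun s' => exists2 k', k' < k & degree_inv k' s') s).
Proof.
case=> i [ik_n iE dE sE]; have nE : s a_size 0 = n by rewrite sE.
have deg_W : s a_degree 0 <= W.
  rewrite dE; apply/bigmax_leqP_seq => x _ _.
  rewrite /vertex_degree; apply: leq_trans (leq_subr _ _) _.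
  apply: leq_trans (offset_le _ _) _; apply: leq_trans degree_sum_le _; lia.
have offE x : s a_offset x = input nb a_offset x by rewrite sE.
split; rewrite /= iE nE; first lia.
move=> lt_i; have next s' : s' a_index 0 = i.+1 ->
    s' a_degree 0 = maxn (s a_degree 0) (vertex_degree i) -> unchanged s' ->
    exists2 k', k' < k & degree_inv k' s'.
  move=> iE' dE' sE'; exists k.-1; first by lia.
  by exists i.+1; split=> //; [lia|rewrite dE' dE big_nat_recr].
have degE : s a_offset (i + 1) - s a_offset i = vertex_degree i.
  by rewrite addn1 !offE !input_offset //; lia.
have off1 := input_offset_W (i + 1); have off0 := input_offset_W i.
rewrite -!offE in off0 off1.
rewrite degE; split; first lia.
  move=> lt_d; rewrite /update /= iE; split; [lia|lia|].
  split; [lia|lia|apply: next => //=; first by lia].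
    by apply/esym/maxn_idPr; rewrite ltnW // -subn_gt0.
  by move=> a x a6 a12; rewrite (negPf a6) (negPf a12) sE.
move=> le_d; rewrite /update /= ?iE; split; [lia|lia|apply: next => //=].
- by lia.
- by apply/esym/maxn_idPl; rewrite -subn_eq0 le_d.
- by move=> a x a6 a12; rewrite (negPf a12) sE.
Qed.

Lemma search_init_step s : unchanged s -> s a_degree 0 = D ->
  wp W (search_init h p)
    (search_inv (\sum_x (size (nb x)).+1)) s.
Proof.
move=> sE dE; have nE : s a_size 0 = n by rewrite sE.
have s0 a i : a \in [:: a_label; a_parent; a_head; a_pos] -> s a i = 0.
  by rewrite !inE => /or4P[] /eqP->; rewrite sE //= /input /= nth_nil.
have Dp_W : p * D <= W by rewrite mulnC; lia.
have highE : h + p * (D - 1) = high D h p by rewrite /high mulnC.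
have high_W : high D h p <= W by lia.
have h_W : h <= W by apply: leq_trans high_W; rewrite /high leq_addr.
have D_W : D <= W by apply: leq_trans Dp_W; rewrite leq_pmull.
have D1p_W : p * (D - 1) <= W by lia.
rewrite /= /update /= !value_times /= dE nE highE.
split; [by []| |split; [lia| |split; [by []|lia|]]].
- by rewrite h_W high_W andbT; apply: fits_times; rewrite /= dE; lia.
- by rewrite high_W mulnC W_top andbT; apply: fits_times; rewrite /= dE ?D_W.
split; [by []|lia|split; [by []|lia|]].
have at_root (F : 'I_n -> Prop) : F root -> forall x, x \in [:: root] -> F x.
  by move=> F0 x; rewrite inE => /eqP->.
exists [:: root], 0, 0; split; split=> //=.
- by move=> x; rewrite inE take0 in_nil !andbF orbF.
- by rewrite big_nil !addn0.
- by move=> i; rewrite sE.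
- by move=> i; rewrite sE.
- by case=> [|i]; rewrite sE // /input /= !nth_nil.
- by rewrite s0.
- by rewrite s0 // /offset take0.
- by rewrite base_label_root take0 addn0.
- exact: at_root.
- by apply: at_root; rewrite /= s0 // label_root.
- by rewrite eqxx mulnC.
Qed.

Definition running_time :=
  n.+1 * (cost degree_test + max_time degree_body).+1 +
  (max_time (search_init h p) +
   (\sum_x (size (nb x)).+1).+1 *
     (cost search_test + max_time (search_body p)).+1).

Lemma tree_labelling_runs :
  runs W (tree_labelling h p) (input nb) running_time
    (fun s => forall x : 'I_n, s a_label x = lab x).
Proof.
apply: runs_seq.
  apply: (runs_while degree_step (k := n)); exists 0; split=> //.
  by rewrite big_geq.
move=> s [[k [i [ik_n iE dE sE]]] /= done_deg].
have nE : s a_size 0 = n by rewrite sE.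
have {}iE : i = n by move: done_deg; rewrite iE nE; lia.
rewrite iE -max_size_nat in dE.
apply: runs_seq; first exact: runs_wp (search_init_step sE dE).
move=> s' init_inv.
have step k' s1 : search_inv k' s1 -> fits W s1 search_test /\
    (0 < value s1 search_test -> wp W (search_body p)
       (fun s2 => exists2 k2, k2 < k' & search_inv k2 s2) s1).
  case=> Q [head [j [SQ RQ]]]; split; first exact: search_test_fits SQ RQ.
  move=> test; have lt_head : head < size Q.
    by move: test; rewrite /= (st_tail RQ) (st_head RQ) subn_gt0.
  exact: (search_body_step SQ RQ lt_head (time_left_gt0 SQ lt_head)).
have [t [s2 [run le_t [[k2 [Q [head [j [SQ RQ]]]]] /= done_s]]]] :=
  runs_while step init_inv.
exists t, s2; split=> // x; apply: (st_label RQ).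
apply: (search_done SQ).
by move/eqP: done_s; rewrite (st_tail RQ) (st_head RQ) subn_eq0.
Qed.

End Search.

(** * The approximation algorithm *)

Section FiniteDegrees.
Variables (n : nat) (T : graph 'I_n) (nb : 'I_n -> seq 'I_n).
Hypotheses (nbP : adjacency_lists T nb).

Lemma deg_adjacency u : deg T u = size (nb u).
Proof. by have [nb_uniq nb_mem] := nbP u; exact: deg_size. Qed.

Lemma max_degree_bigmax (x : 'I_n) :
  is_max_degree T (\max_u size (nb u)).
Proof.
split=> [u|]; first exact: finite_finset.
split=> [|_ [u _ <-]]; last by rewrite deg_adjacency; exact: (leq_bigmax u).
have [|u ->] := eq_bigmax (fun u => size (nb u)).
  by rewrite card_ord (leq_trans _ (ltn_ord x)).
by exists u => //; rewrite deg_adjacency.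
Qed.

Lemma max_edge_degree_exists u v : T u v -> exists D2, is_max_edge_degree T D2.
Proof.
move=> uv; pose D := \max_u size (nb u).
apply: (@ex_maximum _ (deg T u + deg T v) (D + D)); first by exists u, v.
move=> _ [x [y [_ ->]]]; rewrite !deg_adjacency.
by apply: leq_add; [exact: (leq_bigmax x) | exact: (leq_bigmax y)].
Qed.

End FiniteDegrees.

Lemma max_degree_lt (V : countType) (T : graph V) D D2 u v : T u v ->
  is_max_degree T D -> is_max_edge_degree T D2 -> 0 < D < D2.
Proof.
move=> uv [fin [[w _ <-] leD]] [_ leD2].
have pos x y : T x y -> 0 < deg T x.
  have [s [s_uniq sE]] := neighbours_enum (fin x).
  by rewrite (deg_size s_uniq sE) -sE; case: (s).
have w_gt0 : 0 < deg T w.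
  by apply: leq_trans (pos u v uv) _; apply: leD; exists u.
rewrite w_gt0 /=; have [s [s_uniq sE]] := neighbours_enum (fin w).
have [x wx] : exists x, T w x.
  move: w_gt0; rewrite (deg_size s_uniq sE).
  by case: s sE {s_uniq} => // x s sE _; exists x; rewrite -sE mem_head.
have xw : T x w by rewrite (adj_sym T).
apply: (@leq_trans (deg T w + deg T x)); last by apply: leD2; exists w, x.
by rewrite -addn1 leq_add2l; exact: pos xw.
Qed.

(** A tree on [n] vertices has a degree sum of at most [2 * n], so the search
    makes at most [3 * n] iterations, and evaluates its test once more.  The
    last summand makes room for the labels, at most [h + 2 * n * p], and for
    the positions in the array of neighbours. *)
Definition linear_factor (h p : nat) : nat :=
  2 * (cost degree_test + max_time degree_body).+1 +
  max_time (search_init h p) +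
  4 * (cost search_test + max_time (search_body p)).+1 + (h + 2 * p + 3).

Lemma tree_labelling_approximates h p : 0 < p -> p <= h ->
  solves_in_linear_time (tree_labelling h p)
    (fun n (T : graph 'I_n) (f : 'I_n -> nat) =>
       exists D D2 : nat,
         [/\ is_max_degree T D, is_max_edge_degree T D2,
             (epsilon D D2 < 1)%R &
             approximates h p (1 + epsilon D D2)%R T f]).
Proof.
move=> p_gt0 le_ph.
exists (linear_factor h p) => -[|m] T nb treeT [u [v uv]] nbP.
  by case: u {uv}.
have [par [depth rP]] := tree_rooting (ord0 : 'I_m.+1) treeT.
have nb_uniq x : uniq (nb x) by have [] := nbP x.
have nb_mem x y : (y \in nb x) = T x y by have [_ ->] := nbP x.
have maxD := max_degree_bigmax nbP ord0.
have [D2 maxD2] := max_edge_degree_exists nbP uv.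
rewrite -[\max_u _]/(max_size nb) in maxD; set D := max_size nb in maxD.
have /andP[D_gt0 lt_D] := max_degree_lt uv maxD maxD2.
have D_le : D <= m.+1.
  by apply/bigmax_leqP => x _; exact: size_queue.
set W := linear_factor h p * m.+1.
have W_n : 2 * m.+1 < W.
  rewrite /W /linear_factor; set A := 2 * _ + _ + _; lia.
have W_top : high D h p + D * p <= W.
  have : D * p <= m.+1 * p by rewrite leq_mul2r D_le orbT.
  have : (D - 1) * p <= D * p by rewrite leq_mul2r leq_subr orbT.
  rewrite /W /linear_factor /high; set A := 2 * _ + _ + _.
  have : h <= h * m.+1 by rewrite leq_pmulr.
  lia.
have [t [s [run le_t out]]] :=
  tree_labelling_runs rP p_gt0 le_ph nb_uniq nb_mem D_gt0 W_n W_top.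
exists t, s; split=> //.
  apply: leq_trans le_t _; rewrite /running_time /W /linear_factor.
  set K1 := (cost degree_test + _).+1; set K2 := (cost search_test + _).+1.
  set Ki := max_time _; have := degree_sum_le rP nb_uniq nb_mem.
  under [X in _ -> _ + (_ + X.+1 * _) <= _]eq_bigr do rewrite -addn1.
  rewrite big_split sum1_card card_ord /=; set S := \sum_x _ => le_S.
  have : (S + m.+1).+1 * K2 <= 4 * m.+1 * K2 by rewrite leq_mul2r; lia.
  have : m.+2 * K1 <= 2 * m.+1 * K1 by rewrite leq_mul2r; lia.
  have : Ki <= Ki * m.+1 by rewrite leq_pmulr.
  lia.
exists D, D2; split=> //; first exact: epsilon_lt1.
have [l [ls [lP _ lower _ _]]] := tree_span_bounds p_gt0 le_ph treeT maxD maxD2.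
exists (h + 2 * (D - 1) * p), l; split=> //; last exact: span_ratio.
have -> : output s = label ord0 par depth nb D h p.
  by apply/funext => x; exact: out.
by have [] := label_elegant rP p_gt0 le_ph nb_mem D_gt0 (@nb_size _ nb).
Qed.

Theorem theorem3p1 :
  (forall (h p : nat) (V : countType) (T : graph V) (D D2 : nat),
     1 <= p -> p <= h ->
     admissible_tree T -> is_max_degree T D -> is_max_edge_degree T D2 ->
     exists l ls : nat,
       [/\ is_lambda T h p p l,
           is_lambda_star T h p p ls,
           maxn ((D2 - 1) * p) (h + (D - 1) * p) <= l,
           l <= ls &
           ls <= h + 2 * (D - 1) * p])
  /\
  (exists (h p : nat) (V : countType) (T : graph V) (D D2 : nat),
     [/\ 1 <= p <= h, admissible_tree T, is_max_degree T D,
         is_max_edge_degree T D2 &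
         is_lambda T h p p (maxn ((D2 - 1) * p) (h + (D - 1) * p))])
  /\
  (exists (h p : nat) (V : countType) (T : graph V) (D : nat),
     [/\ 1 <= p <= h, admissible_tree T, is_max_degree T D &
         is_lambda T h p p (h + 2 * (D - 1) * p)])
  /\
  (forall h p : nat, 1 <= p -> p <= h ->
     exists A : cmd,
       solves_in_linear_time A (fun n (T : graph 'I_n) (f : 'I_n -> nat) =>
         exists D D2 : nat,
           [/\ is_max_degree T D, is_max_edge_degree T D2,
               (epsilon D D2 < 1)%R &
               approximates h p (1 + epsilon D D2)%R T f])).
Proof.
split; [|split; [|split]].
- move=> h p V T D D2 p_gt0 le_ph [treeT _] maxD maxD2.
  exact: tree_span_bounds.
- exists 1, 1, nat, ray, 2, 4.
  by split; [|exact: ray_admissible|exact: ray_max_degree|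
             exact: ray_max_edge_degree|exact: ray_lambda].
- exists 1, 1, nat, ray, 2.
  by split; [|exact: ray_admissible|exact: ray_max_degree|exact: ray_lambda].
- move=> h p p_gt0 le_ph; exists (tree_labelling h p).
  exact: tree_labelling_approximates.
Qed.
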